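(* Let $a,b\in\mathbb R$ with $b\neq 0$, and put $c=-\frac{a^2+1}{b}$, $d=-a$. Let $J$ be the left-invariant complex structure on $SU(2)\times SU(2)$ determined by $$J(\alpha_1)=a\alpha_1+b\alpha_2,\quad J(\alpha_2)=c\alpha_1+d\alpha_2,\quad J(e_i^+)=e_i^-,\quad J(e_i^-)=-e_i^+\quad (i=1,2).$$ Then $J$ admits a homogeneous CYT structure, i.e. a left-invariant $J$-Hermitian metric which is CYT, if and only if $$b(b-a)>0\quad\text{and}\quad a^2+1-ab>0.$$
   Context: Here $\alpha_i,e_i^+,e_i^-$ ($i=1,2$) is a basis of real left-invariant 1-forms on $SU(2)\times SU(2)$, with index $i$ corresponding to the $i$-th factor, satisfying the Maurer-Cartan equations $$d\alpha_i=e_i^-\wedge e_i^+,\qquad de_i^+=\alpha_i\wedge e_i^-,\qquad de_i^-=-\alpha_i\wedge e_i^+ .$$ For a Hermitian manifold $(M,J,g)$ of complex dimension $n$, the KT (Bismut) connection $\nabla^B$ is the unique connection with $\nabla^B g=0$, $\nabla^B J=0$ whose torsion tensor is totally skew-symmetric (after identifying vectors and 1-forms by $g$). Its Ricci form $\rho^B$ is the real closed 2-form such that $i\rho^B$ is (up to sign convention) the curvature of the connection induced on the anticanonical bundle $K^{-1}$. The metric $g$ is called CYT (Calabi-Yau with torsion) if $\rho^B=0$, equivalently if the restricted holonomy group of $\nabla^B$ is contained in $SU(n)$. *)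

(* Defs.v *)
From HB Require Import structures.
From mathcomp Require Import all_boot all_order all_algebra.
From mathcomp Require Import reals complex.

Set Implicit Arguments.
Unset Strict Implicit.
Unset Printing Implicit Defensive.

Import Order.TTheory GRing.Theory Num.Theory passmx.
Local Open Scope ring_scope.

(* The real Lie algebra su(2), the tangent space of SU(2) at the identity:    *)
(* traceless skew-Hermitian complex matrices, with the commutator bracket.    *)

Definition su2_pred (R : realType) : {pred 'M[R[i]]_2} :=
  [pred M | (map_mx conjc M^T == - M) && (\tr M == 0)].
Arguments su2_pred R : clear implicits.

Lemma su2_predP (R : realType) (M : 'M[R[i]]_2) :
  reflect ((forall i j, conjc (M j i) = - M i j) /\ \tr M = 0)
          (M \in su2_pred R).
Proof.
apply: (iffP andP) => [] [h1 h2]; split; try exact/eqP.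
- by move=> i j; move/eqP/matrixP: h1 => /(_ i j); rewrite !mxE.
- by apply/eqP/matrixP=> i j; rewrite !mxE.
Qed.

Lemma su2_zmod_closed (R : realType) : zmod_closed (su2_pred R).
Proof.
split=> [|A B /su2_predP[hA tA] /su2_predP[hB tB]]; apply/su2_predP; split.
- by move=> i j; rewrite !mxE rmorph0 oppr0.
- exact: mxtrace0.
- by move=> i j; rewrite !mxE rmorphB /= hA hB opprD.
- by rewrite raddfB /= tA tB subrr.
Qed.

HB.instance Definition _ (R : realType) :=
  GRing.isZmodClosed.Build 'M[R[i]]_2 (su2_pred R) (su2_zmod_closed R).

Record su2 (R : realType) : Type :=
  Su2 { su2mx : 'M[R[i]]_2; su2mxP : su2mx \in su2_pred R }.

HB.instance Definition _ (R : realType) := [isSub for @su2mx R].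
HB.instance Definition _ (R : realType) := [Choice of su2 R by <:].
HB.instance Definition _ (R : realType) :=
  [SubChoice_isSubZmodule of su2 R by <:].

Section Su2Module.
Variable R : realType.
Implicit Types (r s : R) (X Y : su2 R).

Lemma su2_scale_subproof r X : real_complex R r *: su2mx X \in su2_pred R.
Proof.
have /su2_predP[hX tX] := su2mxP X; apply/su2_predP; split.
  by move=> i j; rewrite !mxE rmorphM /= hX oppr0 mulrN.
by rewrite mxtraceZ tX mulr0.
Qed.

Definition su2_scale r X : su2 R := Su2 (su2_scale_subproof r X).

Lemma su2_scalerA r s X : su2_scale r (su2_scale s X) = su2_scale (r * s) X.
Proof. by apply: val_inj; rewrite /= scalerA rmorphM. Qed.
Lemma su2_scale1r : left_id 1 su2_scale.
Proof. by move=> X; apply: val_inj; rewrite /= rmorph1 scale1r. Qed.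
Lemma su2_scalerDr : right_distributive su2_scale +%R.
Proof. by move=> r X Y; apply: val_inj; rewrite /= scalerDr. Qed.
Lemma su2_scalerDl X : {morph su2_scale^~ X : r s / r + s}.
Proof. by move=> r s; apply: val_inj; rewrite /= rmorphD scalerDl. Qed.

HB.instance Definition _ := GRing.Zmodule_isLmodule.Build R (su2 R)
  su2_scalerA su2_scale1r su2_scalerDr su2_scalerDl.

(* The coordinates of [[i z, y + i x], [- y + i x, - i z]].                   *)
Definition su2_coord X : 'rV[R]_3 :=
  \row_(k < 3) [:: complex.Im (su2mx X 0 1); complex.Re (su2mx X 0 1);
                   complex.Im (su2mx X 0 0)]`_k.

Definition su2_of_coord_mx (v : 'rV[R]_3) : 'M[R[i]]_2 :=
  \matrix_(j < 2, k < 2)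
    if j == 0 then if k == 0 then Complex 0 (v 0 2) else Complex (v 0 1) (v 0 0)
    else if k == 0 then Complex (- v 0 1) (v 0 0) else Complex 0 (- v 0 2).

Lemma su2_of_coord_subproof v : su2_of_coord_mx v \in su2_pred R.
Proof.
apply/su2_predP; split.
  by case=> [[|[|//]] ?]; case=> [[|[|//]] ?];
    rewrite !mxE //=; apply/eqP; rewrite eq_complex /= ?oppr0 ?opprK !eqxx.
rewrite /mxtrace !big_ord_recl big_ord0 !mxE /=; apply/eqP.
by rewrite eq_complex /= !addr0 subrr eqxx.
Qed.

Lemma su2_of_coordK : cancel su2_coord (fun v => Su2 (su2_of_coord_subproof v)).
Proof.
move=> X; have /su2_predP[hX] := su2mxP X.
rewrite /mxtrace !big_ord_recl big_ord0 addr0.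
have -> : lift ord0 ord0 = 1 :> 'I_2 by apply/val_inj.
move=> /(canRL (addKr _)); rewrite addr0 => h11.
have h10 : su2mx X 1 0 = - conjc (su2mx X 0 1) by rewrite hX opprK.
have h00 : complex.Re (su2mx X 0 0) = 0.
  move: (hX 0 0); case: (su2mx X 0 0) => p q /eqP.
  rewrite eq_complex /= => /andP[/eqP hp _].
  by have := mulrn_eq0 p 2; rewrite mulr2n {1}hp addNr eqxx => /esym /eqP.
have e0 (lt : (0 < 2)%N) : Ordinal lt = 0 :> 'I_2 by apply/val_inj.
have e1 (lt : (1 < 2)%N) : Ordinal lt = 1 :> 'I_2 by apply/val_inj.
apply/val_inj/matrixP => j k /=.
case: j => [[|[|//]] hj]; case: k => [[|[|//]] hk]; rewrite !mxE /= ?e0 ?e1.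
- by move: h00; case: (su2mx X 0 0) => p q /= ->.
- by case: (su2mx X 0 1).
- rewrite h10; case: (su2mx X 0 1) => p q /=; apply/eqP.
  by rewrite eq_complex /= opprK !eqxx.
- rewrite h11; move: h00; case: (su2mx X 0 0) => p q /= ->.
  by apply/eqP; rewrite eq_complex /= oppr0 !eqxx.
Qed.

Lemma su2_vect_axiom : Vector.axiom 3 (su2 R).
Proof.
exists su2_coord.
  move=> r [A hA] [B hB]; apply/rowP=> k; rewrite !mxE.
  case: k => [[|[|[|//]]] hk] /=; rewrite ?mxE /=;
    case: (A _ _) => p q; case: (B _ _) => p' q' /=;
    by rewrite mul0r ?subr0 ?addr0.
exists (fun v => Su2 (su2_of_coord_subproof v)); first exact: su2_of_coordK.
move=> v; apply/rowP => k; rewrite !mxE /=.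
case: k => [[|[|[|//]]] ?]; rewrite /= ?mxE /=; congr (v _ _); exact/val_inj.
Qed.

HB.instance Definition _ := Lmodule_hasFinDim.Build R (su2 R) su2_vect_axiom.

End Su2Module.

Section Su2Bracket.
Variable R : realType.
Implicit Types X Y : su2 R.

Lemma su2_bracket_subproof X Y :
  su2mx X *m su2mx Y - su2mx Y *m su2mx X \in su2_pred R.
Proof.
have /su2_predP[hX _] := su2mxP X; have /su2_predP[hY _] := su2mxP Y.
apply/su2_predP; split; last by rewrite raddfB /= mxtrace_mulC subrr.
move=> j k; rewrite !mxE opprB rmorphB /= !rmorph_sum /=.
by congr (_ - _); apply: eq_bigr => l _; rewrite rmorphM /= hX hY mulrNN mulrC.
Qed.

Definition su2_bracket X Y : su2 R := Su2 (su2_bracket_subproof X Y).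

End Su2Bracket.

(* The Lie algebra of SU(2) x SU(2).  A left-invariant tensor field or        *)
(* connection on the group is given by its value on left-invariant vector     *)
(* fields, that is, by the corresponding multilinear map on this Lie algebra. *)
Definition su2su2 (R : realType) : vectType R := (su2 R * su2 R)%type.

Section LeftInvariantGeometry.
Variable R : realType.
Local Notation L := (su2su2 R).
Implicit Types (X Y Z : L) (J : 'End(L)) (g : L -> L -> R).

Definition factor (i : 'I_2) X : su2 R := if i == 0 then X.1 else X.2.

Definition bracket X Y : L := (su2_bracket X.1 Y.1, su2_bracket X.2 Y.2).

Definition one_form := 'Hom(L, R^o).

(* Exterior derivative of a left-invariant 1-form theta:                      *)
(* X (theta Y) and Y (theta X) vanish because these functions are constant.   *)
Definition ext_d (theta : one_form) X Y : R := - theta (bracket X Y).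

Definition wedge (theta eta : one_form) X Y : R :=
  theta X * eta Y - theta Y * eta X.

Definition from_factor (i : 'I_2) (theta : one_form) : Prop :=
  forall X, factor i X = 0 -> theta X = 0.

Record Maurer_Cartan_coframe (al ep em : 'I_2 -> one_form) : Prop := {
  coframe_basis :
    basis_of fullv [:: al 0; ep 0; em 0; al 1; ep 1; em 1];
  coframe_factor : forall i, [/\ from_factor i (al i),
    from_factor i (ep i) & from_factor i (em i)];
  coframe_d_al : forall i X Y, ext_d (al i) X Y = wedge (em i) (ep i) X Y;
  coframe_d_ep : forall i X Y, ext_d (ep i) X Y = wedge (al i) (em i) X Y;
  coframe_d_em : forall i X Y, ext_d (em i) X Y = - wedge (al i) (ep i) X Y
}.

(* (J theta)(X) = theta (J X).  The convention (J theta)(X) = - theta (J X)   *)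
(* replaces J by - J, which has the same Hermitian metrics and, for each of   *)
(* them, the same Bismut connection.                                          *)
Definition act_form J (theta : one_form) : one_form := (theta \o J)%VF.

Record is_metric g : Prop := {
  metric_linear : forall r X Y Z, g (r *: X + Y) Z = r * g X Z + g Y Z;
  metric_sym : forall X Y, g X Y = g Y X;
  metric_pos : forall X, X != 0 -> 0 < g X X
}.

Definition hermitian J g : Prop :=
  is_metric g /\ forall X Y, g (J X) (J Y) = g X Y.

Implicit Type nabla : 'Hom(L, 'End(L)).

Definition torsion nabla X Y : L := nabla X Y - nabla Y X - bracket X Y.

(* The Bismut connection is unique, hence left-invariant when J and g are, so *)
(* it is enough to look for it among the left-invariant connections.          *)
Record is_bismut J g nabla : Prop := {
  bismut_metric : forall X Y Z, g (nabla X Y) Z + g Y (nabla X Z) = 0;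
  bismut_complex : forall X Y, nabla X (J Y) = J (nabla X Y);
  bismut_torsion : forall X Y Z,
    g (torsion nabla X Y) Z = - g (torsion nabla X Z) Y
}.

Definition curvature nabla X Y : 'End(L) :=
  (nabla X \o nabla Y)%VF - (nabla Y \o nabla X)%VF - nabla (bracket X Y).

(* The complexification of an endomorphism of L, as a matrix acting on row    *)
(* vectors in the basis vbasis fullv.                                         *)
Definition complexify (f : 'End(L)) : 'M[R[i]]_(\dim {: L}) :=
  map_mx (real_complex R) (mxof (vbasis fullv) (vbasis fullv) f).

Definition T10 J : 'M[R[i]]_(\dim {: L}) := eigenspace (complexify J) 'i%C.

(* Curvature of the connection induced by nabla on the top exterior power of  *)
(* T10 J, i.e. the trace of the curvature of nabla on T10 J.                  *)
Definition anticanonical_curvature J nabla X Y : R[i] :=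
  \tr (restrictmx (T10 J) (complexify (curvature nabla X Y))).

(* Characterized by 'i * rho = anticanonical curvature; its values are real   *)
(* when nabla preserves J and a J-Hermitian metric.                           *)
Definition ricci_form J nabla X Y : R[i] :=
  - 'i%C * anticanonical_curvature J nabla X Y.

Definition CYT J g : Prop :=
  exists2 nabla, is_bismut J g nabla
    & forall X Y, ricci_form J nabla X Y = 0.

Definition homogeneous_CYT J : Prop := exists2 g, hermitian J g & CYT J g.

End LeftInvariantGeometry.

(* Main.v *)
From HB Require Import structures.
Require Import Defs.
From mathcomp Require Import all_boot all_order all_algebra.
From mathcomp Require Import reals complex.
From mathcomp Require Import ring lra.

(* On a left-invariant frame the curvature of K^-1 is, up to a factor,        *)
(* (X, Y) |-> tr (J o nabla_[X, Y]), and su(2) + su(2) is spanned by brackets, *)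
(* so CYT means tr (J o nabla_Z) = 0 for every Z.  By unimodularity this trace *)
(* is tr (J o ad Z) + g(V, Z), where V is the sum of the [e_i, J e_i] over a   *)
(* g-orthonormal basis.  Writing h for the dual metric and taking Z dual to    *)
(* al_i, the equation becomes                                                  *)
(*   2 h(al_i, al_1 + al_2) = h(ep_i, ep_i) + h(em_i, em_i) > 0.               *)
(* On the J-invariant plane spanned by al_1, al_2 the metric h is unique up to *)
(* scale, and both signs h(al_i, al_1 + al_2) > 0 are the stated inequalities. *)
(* Conversely, under these inequalities the metric for which the plane of the  *)
(* al_i is orthogonal to the ep_i, em_i and h(ep_i, ep_i) = h(em_i, em_i) =    *)
(* h(al_i, al_1 + al_2) has an explicit Bismut connection with holonomy in a   *)
(* circle of SU(3).                                                            *)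

Set Implicit Arguments.
Unset Strict Implicit.
Unset Printing Implicit Defensive.

Import Order.TTheory GRing.Theory Num.Theory passmx.
Local Open Scope ring_scope.

(** The reduction to [tr (J \o nabla Z)] rests on [mxtrace_complexify_T10], [tr_curvature] and
    [frame_bracket]; [tr_bismut] evaluates that trace for an arbitrary Hermitian metric. Necessity
    uses only the defining properties of a Bismut connection, and [CYT_sufficient] exhibits one for
    a single metric, so no general existence result enters. *)

(** * Linear algebra: dual bases and traces *)

Section LfunOfLinear.
Variables (K : fieldType) (U V : vectType K) (f : U -> V) (lf : linear f).

(** The alias carries the proof [lf], so the linear structure is attached to [F lf] and not to the
    bare variable [f]. *)
Let F of linear f := f.
HB.instance Definition _ := GRing.isLinear.Build K U V *:%R (F lf) lf.

Lemma ex_lfun : exists h : 'Hom(U, V), h =1 f.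
Proof. by exists (linfun (F lf)) => x; rewrite lfunE. Qed.

End LfunOfLinear.

Lemma inj_lfun_surj (K : fieldType) (U V : vectType K) (h : 'Hom(U, V)) :
  (forall u, h u = 0 -> u = 0) -> \dim {: V} = \dim {: U} ->
  forall v, exists u, h u = v.
Proof.
move=> ker0 dimUV v; have im : limg h = fullv.
  apply/eqP; rewrite eqEdim subvf limg_dim_eq ?dimUV ?leqnn //.
  apply/eqP; rewrite -subv0; apply/subvP=> u.
  by rewrite memv_cap memv_ker memv0 => /andP[_ /eqP /ker0 ->].
have : v \in limg h by rewrite im memvf.
by case/memv_imgP=> u _ ->; exists u.
Qed.

Section DualBasis.
Variables (K : fieldType) (V : vectType K).

Lemma dim_dual : \dim {: 'Hom(V, K^o)} = \dim {: V}.
Proof. by rewrite !dimvf /dim /= muln1. Qed.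

Lemma lfun_separates (v : V) : (forall h : 'Hom(V, K^o), h v = 0) -> v = 0.
Proof.
move=> h0; rewrite (coord_vbasis (memvf v)) big1 // => i _.
have [h hE] := @ex_lfun K V K^o (coord (vbasis fullv) i) (@linearP _ _ _ _ _).
by rewrite -hE h0 scale0r.
Qed.

(** Evaluation of the forms in [X] is injective from [V] to [K^n], as forms separate vectors, hence
    bijective by dimension; [e] consists of the preimages of the unit vectors. *)
Lemma ex_dual_basis n (X : n.-tuple 'Hom(V, K^o)) : basis_of fullv X ->
  exists e : 'I_n -> V, (forall i j, tnth X i (e j) = (i == j)%:R) /\
    (forall v, v = \sum_i tnth X i v *: e i).
Proof.
move=> bX; have [phi phiE] : exists h : 'Hom(V, 'rV[K]_n),
    h =1 (fun v => \row_i tnth X i v).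
  by apply: ex_lfun => r u v; apply/rowP=> i; rewrite !mxE linearP.
have ker0 v : phi v = 0 -> v = 0.
  move=> /rowP pv; apply: lfun_separates => h.
  rewrite (coord_basis bX (memvf h)) sum_lfunE big1 // => i _.
  have := pv i; rewrite phiE !mxE (tnth_nth 0) => h0.
  by rewrite scale_lfunE h0 scaler0.
have dimV : \dim {: V} = n by rewrite -dim_dual -(size_basis bX).
have pre j : exists v, phi v == delta_mx 0 j.
  have dimUV : \dim {: 'rV[K]_n} = \dim {: V} by rewrite dimV dimvf /dim /= mul1n.
  by have [v vE] := inj_lfun_surj ker0 dimUV (delta_mx 0 j); exists v; apply/eqP.
pose e (j : 'I_n) := xchoose (pre j).
have eE i j : tnth X i (e j) = (i == j)%:R.
  by have /eqP/rowP/(_ i) := xchooseP (pre j); rewrite phiE !mxE.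
exists e; split=> // v; apply/eqP; rewrite -subr_eq0; apply/eqP/ker0.
rewrite phiE; apply/rowP=> i; rewrite !mxE raddfB raddf_sum (bigD1 i) //=.
rewrite big1 => [|j ji]; rewrite linearZ /= eE ?eqxx ?[_ *: _]mulr1 ?addr0 ?subrr //.
by rewrite eq_sym (negPf ji) scaler0.
Qed.

Definition tr (f : 'End(V)) : K := \tr (mxof (vbasis fullv) (vbasis fullv) f).

(** Expanding in [e] factors the matrix of [f] in [vbasis fullv] into two rectangular matrices;
    exchanging them under the trace gives the sum. *)
Lemma trE n (th : 'I_n -> 'Hom(V, K^o)) (e : 'I_n -> V) (f : 'End(V)) :
  (forall v, v = \sum_i th i v *: e i) -> tr f = \sum_i th i (f (e i)).
Proof.
move=> eE; pose B := vbasis (@fullv K V).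
have -> : tr f = \tr ((\matrix_(i, k) (th k B`_i : K)) *m
    (\matrix_(k, j) coord B j (f (e k)))).
  congr (\tr _); apply/matrixP=> i j; rewrite !mxE vecof_delta /=.
  rewrite {1}(eE B`_i) !raddf_sum /=; apply: eq_bigr => k _.
  by rewrite !linearZ /= !mxE.
rewrite mxtrace_mulC; apply: eq_bigr => k _; rewrite !mxE.
rewrite {1}(coord_vbasis (memvf (f (e k)))) raddf_sum; apply: eq_bigr => j _.
by rewrite !mxE /= linearZ.
Qed.

Lemma trB (f h : 'End(V)) : tr (f - h) = tr f - tr h.
Proof. by rewrite /tr !raddfB. Qed.

Lemma tr_compC (f h : 'End(V)) : tr (f \o h) = tr (h \o f).
Proof.
have bV := vbasisP (@fullv K V).
by rewrite /tr !(mxof_comp _ _ bV) mxtrace_mulC.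
Qed.

End DualBasis.

(** Here [P] is a projection onto the row space of [V]. With [B] a row base, [P = Q *m B] and
    [B *m Q = 1], so the restriction of [f] is [B *m f *m Q]. *)
Lemma mxtrace_restrict (F : fieldType) n (V P f : 'M[F]_n) :
  (P <= V)%MS -> V *m P = V -> f *m P = P *m f ->
  \tr (restrictmx V f) = \tr (f *m P).
Proof.
move=> /submxP[Q0 PE] VP fP; set B := row_base V.
have [D BE] : exists D, B = D *m V by apply/submxP; rewrite eq_row_base.
have [C VE] : exists C, V = C *m B by apply/submxP; rewrite eq_row_base.
have BP : B *m P = B by rewrite BE -mulmxA VP.
have [Q PQ] : exists Q, P = Q *m B by exists (Q0 *m C); rewrite -mulmxA -VE.
have freeB : row_free B by rewrite row_base_free.
have BQ : B *m Q = 1%:M by apply: (row_free_inj freeB); rewrite -mulmxA -PQ BP mul1mx.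
have BfE : B *m f = B *m f *m Q *m B by rewrite -(mulmxA _ Q B) -PQ -(mulmxA B) fP (mulmxA B) BP.
by rewrite /conjmx -/B BfE mulmxKp // mxtrace_mulC mulmxA -PQ mxtrace_mulC.
Qed.

(** * Complex trace on T10 in terms of real traces *)

Section RicciTrace.
Variable R : realType.
Local Notation L := (su2su2 R).
Local Notation C := (real_complex R).

Lemma mxtrace_complexify_T10 (J f : 'End(L)) :
  (forall X, J (J X) = - X) -> (forall X, f (J X) = J (f X)) ->
  \tr (restrictmx (T10 J) (complexify f)) =
  (2%:R)^-1 * (C (tr f) - 'i%C * C (tr (J \o f))).
Proof.
move=> JJ fJ; have bL := vbasisP (@fullv R L).
pose M := complexify J; have i2 : 'i%C * 'i%C = -1 :> R[i].
  by apply/eqP; rewrite eq_complex /= !mulr0 !mul0r mulr1 !sub0r addr0 oppr0 !eqxx.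
have compE (h1 h2 : 'End(L)) : complexify (h1 \o h2) = complexify h2 *m complexify h1.
  by rewrite /complexify (mxof_comp _ _ bL) map_mxM.
have MM : M *m M = - 1%:M.
  rewrite -compE; have -> : (J \o J)%VF = - \1%VF.
    by apply/lfunP=> X; rewrite comp_lfunE JJ opp_lfunE id_lfunE.
  by rewrite /complexify raddfN /= mxof1 ?(basis_free bL) // map_mxN map_mx1.
have fM : complexify f *m M = M *m complexify f.
  rewrite -!compE; congr complexify; apply/lfunP=> X; rewrite !comp_lfunE.
  by rewrite fJ.
(* Since [M] squares to [-1], this is the projection onto its ['i]-eigenspace along the
   [-'i]-eigenspace. *)
pose P := (2%:R)^-1 *: (1%:M - 'i%C *: M).
have two0 : (2%:R : R[i]) != 0 by rewrite pnatr_eq0.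
rewrite (@mxtrace_restrict _ _ _ P).
- rewrite -scalemxAr mxtraceZ mulmxBr mulmx1 -scalemxAr -compE raddfB /= mxtraceZ.
  by rewrite /complexify !trace_map_mx.
- apply/eigenspaceP; rewrite -scalemxAl mulmxBl mul1mx -scalemxAl MM.
  rewrite scalerA mulrC -scalerA; congr (_ *: _).
  by rewrite scalerBr scalerA i2 scaleN1r scalerN !opprK addrC.
- have /eigenspaceP VM : (T10 J <= T10 J)%MS by [].
  rewrite -scalemxAr mulmxBr mulmx1 -scalemxAr VM scalerA i2 scaleN1r opprK.
  by rewrite -mulr2n -[T10 J *+ 2]scaler_nat scalerA mulVf // scale1r.
- by rewrite -scalemxAr -scalemxAl mulmxBr mulmxBl mulmx1 mul1mx -scalemxAr -scalemxAl fM.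
Qed.

End RicciTrace.

Section Bracket.
Variable R : realType.
Local Notation L := (su2su2 R).

Lemma su2_bracket_linear (X : su2 R) : linear (su2_bracket X).
Proof.
move=> r Y Z; apply: val_inj; rewrite /= mulmxDr mulmxDl -scalemxAr -scalemxAl.
by rewrite scalerBr opprD addrACA.
Qed.

Lemma bracket_linear (X : L) : linear (bracket X).
Proof. by move=> r Y Z; rewrite /bracket /= !su2_bracket_linear. Qed.

Lemma bracketC (X Y : L) : bracket X Y = - bracket Y X.
Proof. by congr pair; apply: val_inj; rewrite /= opprB. Qed.

End Bracket.

(** * Traces computed with a metric *)

Section Metric.
Variable R : realType.
Local Notation L := (su2su2 R).
Variables (g : L -> L -> R) (gP : is_metric g).

Lemma metricDl X Y Z : g (X + Y) Z = g X Z + g Y Z.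
Proof. by have := metric_linear gP 1 X Y Z; rewrite scale1r mul1r. Qed.

Lemma metric0l Z : g 0 Z = 0.
Proof. by have := metricDl 0 0 Z; rewrite addr0; lra. Qed.

Lemma metricZl r X Z : g (r *: X) Z = r * g X Z.
Proof. by have := metric_linear gP r X 0 Z; rewrite !addr0 metric0l addr0. Qed.

Lemma metricNl X Z : g (- X) Z = - g X Z.
Proof. by rewrite -scaleN1r metricZl mulN1r. Qed.

Lemma metricZr r X Z : g X (r *: Z) = r * g X Z.
Proof. by rewrite !(metric_sym gP X) metricZl. Qed.

Lemma metric_suml (I : finType) (F : I -> L) Z :
  g (\sum_i F i) Z = \sum_i g (F i) Z.
Proof. by apply: (big_morph (g^~ Z) (fun X Y => metricDl X Y Z) (metric0l Z)). Qed.

Lemma metric_sumr (I : finType) (F : I -> L) Z :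
  g Z (\sum_i F i) = \sum_i g Z (F i).
Proof. by rewrite metric_sym // metric_suml; apply: eq_bigr => i _; apply: metric_sym. Qed.

Lemma metric_riesz (th : one_form R) : exists X, forall Y, g X Y = th Y.
Proof.
pose b := vbasis (@fullv R L).
have [phi phiE] : exists h : 'Hom(L, 'rV[R]_(\dim {: L})),
    h =1 (fun X => \row_i g X b`_i).
  by apply: ex_lfun => r u v; apply/rowP=> i; rewrite !mxE (metric_linear gP).
have gE X Y : g X Y = \sum_i coord b i Y * phi X 0 i.
  rewrite {1}(coord_vbasis (memvf Y)) metric_sumr.
  by apply: eq_bigr => i _; rewrite metricZr phiE mxE.
have ker0 X : phi X = 0 -> X = 0.
  move=> phi0; apply/eqP; apply: contraT => /(metric_pos gP).
  by rewrite gE big1 ?ltxx // => i _; rewrite phi0 mxE mulr0.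
have [|X XE] := inj_lfun_surj ker0 _ (\row_i th b`_i).
  by rewrite dimvf /dim /= mul1n.
exists X => Y; rewrite gE XE {2}(coord_vbasis (memvf Y)) linear_sum /=.
by apply: eq_bigr => i _; rewrite mxE linearZ.
Qed.

Variables (n : nat) (th : 'I_n -> one_form R) (e : 'I_n -> L).
Hypothesis eE : forall X, X = \sum_i th i X *: e i.
(** [f i] is the metric dual of the form [th i]; the pairs [(e i, f i)] do the work of an
    orthonormal basis without orthonormalizing. *)
Variable f : 'I_n -> L.
Hypothesis fE : forall i X, g (f i) X = th i X.

Lemma tr_metric (h : 'End(L)) : tr h = \sum_i g (h (e i)) (f i).
Proof.
by rewrite (trE h eE); apply: eq_bigr => i _; rewrite metric_sym // fE.
Qed.

(** The roles of [e] and [f] may be exchanged because the transition coefficients [g (f i) (f j)]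
    are symmetric. *)
Lemma tr_metric_sharp (h : 'End(L)) : tr h = \sum_i g (h (f i)) (e i).
Proof.
rewrite tr_metric; transitivity (\sum_i \sum_j g (f i) (f j) * g (h (e i)) (e j)).
  apply: eq_bigr => i _; rewrite {1}(eE (f i)) metric_sumr.
  by apply: eq_bigr => j _; rewrite metricZr -fE metric_sym.
rewrite exchange_big; apply: eq_bigr => j _ /=.
rewrite {2}(eE (f j)) linear_sum metric_suml; apply: eq_bigr => i _.
by rewrite linearZ /= metricZl -fE.
Qed.

Lemma tr_skew (h : 'End(L)) : (forall X Y, g (h X) Y = - g (h Y) X) -> tr h = 0.
Proof.
move=> skew; suff : tr h = - tr h by lra.
rewrite {1}tr_metric tr_metric_sharp -sumrN.
by apply: eq_bigr => i _.
Qed.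

End Metric.

(** * The trace of J composed with the Bismut connection *)

Section BismutTrace.
Variable R : realType.
Local Notation L := (su2su2 R).
Variables (J : 'End(L)) (g : L -> L -> R) (nabla : 'Hom(L, 'End(L))).
Hypotheses (JJ : forall X, J (J X) = - X) (gH : Defs.hermitian J g).
Hypothesis hB : is_bismut J g nabla.
Variables (n : nat) (th : 'I_n -> one_form R) (e : 'I_n -> L).
Hypothesis eE : forall X, X = \sum_i th i X *: e i.
Variable f : 'I_n -> L.
Hypothesis fE : forall i X, g (f i) X = th i X.
Hypothesis unimodular : forall X, \sum_i th i (bracket X (e i)) = 0.
Let gP : is_metric g := proj1 gH.

Lemma hermitian_skew X Y : g (J X) Y = - g X (J Y).
Proof. by have [_ gJ] := gH; rewrite -gJ JJ metricNl. Qed.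

(** With [D X = nabla X Z], [nabla Z] is the sum of [D], [ad Z] and the torsion [T(Z, _)]. The trace
    of [J \o D] vanishes, and total skewness turns the trace of [J \o T(Z, _)] into minus the sum of
    [g (T(e i, J (f i))) Z]. *)
Lemma tr_bismut Z :
  tr (J \o nabla Z) =
  \sum_i th i (J (bracket Z (e i))) + \sum_i g (bracket (e i) (J (f i))) Z.
Proof.
have exD W : exists h : 'End(L), h =1 (fun X => nabla X W).
  by apply: ex_lfun => r X Y; rewrite linearP add_lfunE scale_lfunE.
have exT W : exists h : 'End(L), h =1 torsion nabla W.
  apply: ex_lfun => r X Y; rewrite /torsion bracket_linear.
  rewrite [nabla (_ + _)]linearP [nabla W (_ + _)]linearP /=.
  by rewrite add_lfunE scale_lfunE 2!scalerBr !opprD [X in X + _ = _]addrACA [LHS]addrACA.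
(* Unimodularity makes D : X |-> nabla X W traceless, since nabla W and        *)
(* nabla W - D - ad W = T(W, _) are skew.                                      *)
have trD W (D : 'End(L)) : D =1 (fun X => nabla X W) -> tr D = 0.
  move=> DE; have [T TE] := exT W.
  suff -> : tr D = tr (nabla W) - tr T.
    rewrite (tr_skew gP eE fE) => [|X Y].
      rewrite (tr_skew gP eE fE) ?subrr // => X Y.
      by rewrite !TE (bismut_torsion hB).
    by have := bismut_metric hB W X Y; rewrite (metric_sym gP X); lra.
  rewrite !(tr_metric gP eE fE) -[RHS]subr0 -[X in _ = _ - X](unimodular W) -!sumrB.
  apply: eq_bigr => i _.
  rewrite DE TE /torsion -(fE i) (metric_sym gP (f i)) -!metricNl // -!metricDl //.
  by congr (g _ _); rewrite opprB addrAC addrA subrK subKr.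
have [D DE] := exD Z.
have trJD : tr (J \o D) = 0.
  apply: (trD (J Z)) => X; by rewrite comp_lfunE DE (bismut_complex hB).
have trDJ : tr (D \o J) = 0 by rewrite tr_compC.
pose T := \sum_i g (J (torsion nabla Z (e i))) (f i).
have -> : tr (J \o nabla Z) = \sum_i th i (J (bracket Z (e i))) + T.
  rewrite -[RHS]add0r -[X in _ = X + _]trJD !(tr_metric gP eE fE) -!big_split /=.
  apply: eq_bigr => i _; rewrite !comp_lfunE DE -(fE i) (metric_sym gP (f i)).
  rewrite -!metricDl // -!linearD /=; congr (g (J _) _).
  by rewrite /torsion addrA -(addrA (nabla Z _)) -opprD addrC subrK.
(* The two zero traces absorb the derivative terms of the torsion of [e i] and [J (f i)], leaving
   only their bracket. *)
congr (_ + _); rewrite -[LHS]addr0 -[X in _ + X = _]trDJ -[LHS]addr0 -[X in _ + X = _]trJD.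
rewrite (tr_metric_sharp gP eE fE (D \o J)) (tr_metric gP eE fE) -!big_split /=.
apply: eq_bigr => i _; rewrite !comp_lfunE !DE.
have torC X Y : torsion nabla X Y = - torsion nabla Y X.
  by rewrite /torsion (bracketC X) !opprD !opprK; congr (_ + _); rewrite addrC.
have -> : bracket (e i) (J (f i)) =
    nabla (e i) (J (f i)) - nabla (J (f i)) (e i) - torsion nabla (e i) (J (f i)).
  by rewrite /torsion subKr.
rewrite !metricDl // !metricNl //.
rewrite (bismut_torsion hB (e i)) (torC (e i)) metricNl // !hermitian_skew.
have := bismut_metric hB (e i) (J (f i)) Z.
have := bismut_metric hB (J (f i)) (e i) Z.
rewrite (metric_sym gP (nabla (e i) Z)) (metric_sym gP (nabla (J (f i)) Z)).
by rewrite hermitian_skew; move=> h1 h2; lra.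
Qed.

End BismutTrace.

(** * The Ricci form as a trace of the connection *)

Section RicciForm.
Variable R : realType.
Local Notation L := (su2su2 R).
Variables (J : 'End(L)) (nabla : 'Hom(L, 'End(L))).
Hypothesis JJ : forall X, J (J X) = - X.
Hypothesis nablaJ : forall X Y, nabla X (J Y) = J (nabla X Y).

Lemma curvatureJ X Y Z : curvature nabla X Y (J Z) = J (curvature nabla X Y Z).
Proof.
by rewrite /curvature !add_lfunE !opp_lfunE !comp_lfunE !nablaJ !linearB.
Qed.

Lemma ricci_form_eq0 X Y :
  ricci_form J nabla X Y = 0 <->
  tr (curvature nabla X Y) = 0 /\ tr (J \o curvature nabla X Y) = 0.
Proof.
rewrite /ricci_form /anticanonical_curvature mxtrace_complexify_T10 //; last first.
  exact: curvatureJ.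
move: (tr _) (tr _) => t u; split=> [|[-> ->]]; last first.
  by rewrite rmorph0 mulr0 subr0 !mulr0.
move/eqP; rewrite !mulf_eq0 oppr_eq0 invr_eq0 pnatr_eq0 /= => /orP[|].
  by rewrite eq_complex /= oner_eq0 andbF.
by rewrite eq_complex /= => /andP[/eqP h1 /eqP h2]; split; lra.
Qed.

(** [J] commutes with [nabla X] and [nabla Y], so by cyclicity their commutator contributes
    nothing. *)
Lemma tr_curvature X Y :
  tr (J \o curvature nabla X Y) = - tr (J \o nabla (bracket X Y)).
Proof.
rewrite /curvature !comp_lfunDr !comp_lfunNr !trB.
suff -> : tr (J \o (nabla X \o nabla Y)) = tr (J \o (nabla Y \o nabla X)).
  by rewrite subrr sub0r.
rewrite tr_compC -comp_lfunA tr_compC; congr tr; apply/lfunP=> Z.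
by rewrite !comp_lfunE !nablaJ.
Qed.

End RicciForm.

Lemma big_ord6 (V : zmodType) (F : 'I_6 -> V) :
  \sum_i F i = F (inord 0) + F (inord 1) + F (inord 2) + F (inord 3) +
              F (inord 4) + F (inord 5).
Proof.
rewrite !big_ord_recl big_ord0 addr0 !addrA.
by do !congr (_ + _); congr F; apply: val_inj; rewrite /= inordK.
Qed.

(** * The Lie algebra in the Maurer-Cartan frame *)

Section Frame.
Variable R : realType.
Local Notation L := (su2su2 R).
Variables al ep em : 'I_2 -> one_form R.
Hypothesis coframe : Maurer_Cartan_coframe al ep em.

(** Positions [3 * i], [3 * i + 1], [3 * i + 2] hold [al i], [ep i], [em i]. *)
Definition coframe_tuple : 6.-tuple (one_form R) :=
  [tuple al 0; ep 0; em 0; al 1; ep 1; em 1].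

(** With the next two lemmas: on each factor the bracket is the cross product in the coordinates
    [(al i, ep i, em i)]. *)
Lemma al_bracket i X Y : al i (bracket X Y) = ep i X * em i Y - em i X * ep i Y.
Proof. by have := coframe_d_al coframe i X Y; rewrite /ext_d /wedge; lra. Qed.

Lemma ep_bracket i X Y : ep i (bracket X Y) = em i X * al i Y - al i X * em i Y.
Proof. by have := coframe_d_ep coframe i X Y; rewrite /ext_d /wedge; lra. Qed.

Lemma em_bracket i X Y : em i (bracket X Y) = al i X * ep i Y - ep i X * al i Y.
Proof. by have := coframe_d_em coframe i X Y; rewrite /ext_d /wedge; lra. Qed.

Definition bracketE := (al_bracket, ep_bracket, em_bracket).

Lemma frame_exists : exists e : 'I_6 -> L,
  (forall i j, tnth coframe_tuple i (e j) = (i == j)%:R) /\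
  (forall X, X = \sum_i tnth coframe_tuple i X *: e i).
Proof. exact: (ex_dual_basis (coframe_basis coframe)). Qed.

Lemma coframe_sep X Y : (forall i, al i X = al i Y) -> (forall i, ep i X = ep i Y) ->
  (forall i, em i X = em i Y) -> X = Y.
Proof.
move=> hal hep hem; have [e [_ eE]] := frame_exists.
rewrite (eE X) (eE Y); apply: eq_bigr => i _; congr (_ *: _).
by case: i => [[|[|[|[|[|[|//]]]]]] ?]; rewrite !(tnth_nth 0) /=.
Qed.

Variable e : 'I_6 -> L.
Hypothesis thE : forall i j, tnth coframe_tuple i (e j) = (i == j)%:R.

Lemma al_frame i j : al i (e j) = (j == (3 * i)%N :> nat)%:R.
Proof.
by case: i j => [[|[|//]] hi] [j hj]; [have := thE (@Ordinal 6 0 isT) (Ordinal hj)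
  | have := thE (@Ordinal 6 3 isT) (Ordinal hj)]; rewrite (tnth_nth 0) /= -val_eqE /= eq_sym => <-;
  congr (al _ _); apply: val_inj.
Qed.

Lemma ep_frame i j : ep i (e j) = (j == (3 * i).+1%N :> nat)%:R.
Proof.
by case: i j => [[|[|//]] hi] [j hj]; [have := thE (@Ordinal 6 1 isT) (Ordinal hj)
  | have := thE (@Ordinal 6 4 isT) (Ordinal hj)]; rewrite (tnth_nth 0) /= -val_eqE /= eq_sym => <-;
  congr (ep _ _); apply: val_inj.
Qed.

Lemma em_frame i j : em i (e j) = (j == (3 * i).+2%N :> nat)%:R.
Proof.
by case: i j => [[|[|//]] hi] [j hj]; [have := thE (@Ordinal 6 2 isT) (Ordinal hj)
  | have := thE (@Ordinal 6 5 isT) (Ordinal hj)]; rewrite (tnth_nth 0) /= -val_eqE /= eq_sym => <-;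
  congr (em _ _); apply: val_inj.
Qed.

Definition frameE := (al_frame, ep_frame, em_frame).

Lemma sum_coframe (F : 'I_6 -> L) : \sum_i tnth coframe_tuple i (F i) =
  al 0 (F (inord 0)) + ep 0 (F (inord 1)) + em 0 (F (inord 2)) +
  al 1 (F (inord 3)) + ep 1 (F (inord 4)) + em 1 (F (inord 5)).
Proof. by rewrite big_ord6 !(tnth_nth 0) !inordK. Qed.

Lemma coframe_unimodular X : \sum_i tnth coframe_tuple i (bracket X (e i)) = 0.
Proof. by rewrite sum_coframe !bracketE !frameE !inordK //=; ring. Qed.

Lemma frame_bracket i : exists X Y, e i = bracket X Y.
Proof.
pose p (j : nat) : L := e (inord j).
(* As for the cross product, a frame vector is the bracket of its two cyclic successors within its
   factor. *)
exists (p (if (i < 3)%N then i.+1 %% 3 else 3 + i.+1 %% 3)%N).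
exists (p (if (i < 3)%N then i.+2 %% 3 else 3 + i.+2 %% 3)%N).
case: i => [[|[|[|[|[|[|//]]]]]] ?]; apply: coframe_sep => -[[|[|//]] hk];
  rewrite !bracketE /p !frameE !inordK //=; ring.
Qed.

End Frame.

Section OneForm.
Variables (R : realType) (th : one_form R).

Lemma one_formP r X Y : th (r *: X + Y) = r * th X + th Y.
Proof. exact: linearP. Qed.

Lemma one_formZ r X : th (r *: X) = r * th X.
Proof. exact: linearZ. Qed.

Lemma one_formB X Y : th (X - Y) = th X - th Y.
Proof. exact: raddfB. Qed.

End OneForm.

Lemma ord2_ind (P : 'I_2 -> Prop) : P 0 -> P 1 -> forall i, P i.
Proof.
move=> P0 P1 [[|[|//]] hi]; [have -> : Ordinal hi = 0 | have -> : Ordinal hi = 1];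
  by [| apply: val_inj].
Qed.

Section ComplexStructure.
Variable R : realType.
Local Notation L := (su2su2 R).
Variables al ep em : 'I_2 -> one_form R.
Hypothesis coframe : Maurer_Cartan_coframe al ep em.
Variables (a b c d : R) (b0 : b != 0).
Hypotheses (hc : c = - ((a ^+ 2 + 1) / b)) (hd : d = - a).
Variable J : 'End(L).
Hypotheses (hJal1 : act_form J (al 0) = a *: al 0 + b *: al 1)
  (hJal2 : act_form J (al 1) = c *: al 0 + d *: al 1)
  (hJep : forall i : 'I_2, act_form J (ep i) = em i)
  (hJem : forall i : 'I_2, act_form J (em i) = - ep i).

Lemma al0_J X : al 0 (J X) = a * al 0 X + b * al 1 X.
Proof. by have /lfunP/(_ X) := hJal1; rewrite comp_lfunE add_lfunE !scale_lfunE. Qed.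

Lemma al1_J X : al 1 (J X) = c * al 0 X - a * al 1 X.
Proof.
by have /lfunP/(_ X) := hJal2; rewrite comp_lfunE add_lfunE !scale_lfunE hd => ->;
  rewrite scaleNr.
Qed.

Lemma ep_J i X : ep i (J X) = em i X.
Proof. by have /lfunP/(_ X) := hJep i; rewrite comp_lfunE. Qed.

Lemma em_J i X : em i (J X) = - ep i X.
Proof. by have /lfunP/(_ X) := hJem i; rewrite comp_lfunE opp_lfunE. Qed.

Definition actE := (al0_J, al1_J, ep_J, em_J).

(** On the [al] plane this is [a ^+ 2 + b * c = -1], which is the choice of [c]. *)
Lemma square_J X : J (J X) = - X.
Proof.
apply: (coframe_sep coframe) => [||]; first apply: ord2_ind; last 2 first.
- by move=> i; rewrite !actE raddfN.
- by move=> i; rewrite !actE raddfN.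
- by rewrite !actE raddfN hc; field.
- by rewrite !actE raddfN hc; field.
Qed.

(** * A CYT metric forces the inequalities *)

Section Necessity.
Variables (g : L -> L -> R) (nabla : 'Hom(L, 'End(L))).
Hypotheses (gH : Defs.hermitian J g) (hB : is_bismut J g nabla).
Hypothesis ricci0 : forall X Y, ricci_form J nabla X Y = 0.

Lemma CYT_necessary : 0 < b * (b - a) /\ 0 < a ^+ 2 + 1 - a * b.
Proof.
have [gP gJ] := gH; have [e [thE eE]] := frame_exists coframe.
pose th := tnth (coframe_tuple al ep em).
have trJ0 Z : tr (J \o nabla Z) = 0.
  have trJbr X Y : tr (J \o nabla (bracket X Y)) = 0.
    apply: oppr_inj; rewrite oppr0 -(tr_curvature (bismut_complex hB)).
    by case/(ricci_form_eq0 square_J (bismut_complex hB)): (ricci0 X Y).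
  have [h hE] : exists h : one_form R, h =1 (fun X => tr (J \o nabla X)).
    apply: ex_lfun => r X Y.
    by rewrite linearP comp_lfunDr -comp_lfunZr /tr linearP /= mxtraceD mxtraceZ.
  rewrite -[LHS]hE (eE Z) linear_sum big1 // => i _; rewrite linearZ /= hE.
  by have [X [Y ->]] := frame_bracket coframe thE i; rewrite trJbr scaler0.
(* Below al 1 (f 0) is h(al_1, al_2), and so on. *)
have /fin_all_exists [f fE] i : exists X, forall Y, g X Y = th i Y.
  exact: metric_riesz.
(* The first term is the trace of [J \o ad Z]: each of the four [ep], [em] directions contributes
   the [al] coordinate of its factor. *)
have trace Z : 2%:R * (al 0 Z + al 1 Z) + \sum_i g (bracket (e i) (J (f i))) Z = 0.
  rewrite -[RHS](trJ0 Z) (tr_bismut square_J gH hB eE fE (coframe_unimodular coframe thE)).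
  congr (_ + _); rewrite sum_coframe !(al0_J, al1_J, ep_J, em_J).
  by rewrite !(bracketE coframe) !(frameE thE) !inordK //=; ring.
have gal0 Y : g (f (inord 0)) Y = al 0 Y by rewrite fE /th (tnth_nth 0) inordK.
have gep0 Y : g (f (inord 1)) Y = ep 0 Y by rewrite fE /th (tnth_nth 0) inordK.
have gem0 Y : g (f (inord 2)) Y = em 0 Y by rewrite fE /th (tnth_nth 0) inordK.
have gal1 Y : g (f (inord 3)) Y = al 1 Y by rewrite fE /th (tnth_nth 0) inordK.
have gep1 Y : g (f (inord 4)) Y = ep 1 Y by rewrite fE /th (tnth_nth 0) inordK.
have gem1 Y : g (f (inord 5)) Y = em 1 Y by rewrite fE /th (tnth_nth 0) inordK.
have pos j : (j < 6)%N -> 0 < g (f (inord j)) (f (inord j)).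
  move=> hj; apply: (metric_pos gP); apply/eqP => f0.
  have := thE (inord j) (inord j); rewrite -/th -fE f0 (metric0l gP) eqxx.
  by move/eqP; rewrite eq_sym oner_eq0.
have := trace (f (inord 0)); have := trace (f (inord 3)).
rewrite !big_ord6 -!(metric_sym gP (f _)) !gal0 !gal1 !(bracketE coframe) !(frameE thE).
rewrite !inordK //= !(ep_J, em_J).
have := pos 0%N isT; have := pos 1%N isT; have := pos 2%N isT.
have := pos 4%N isT; have := pos 5%N isT.
rewrite gal0 gep0 gem0 gep1 gem1.
(* Skewness of [J] on [f 0] and [f 3] determines the metric on the [al] plane from [s]:
   [b * h01 = - (a * s)] and [b * h11 = - (c * s)]. *)
have := gal1 (f (inord 0)); rewrite (metric_sym gP) gal0.
have := gal0 (J (f (inord 0))); have := gal1 (J (f (inord 0))).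
rewrite -(metric_sym gP _ (f (inord 0))) (hermitian_skew square_J gH) gal0 al0_J al1_J.
have := hermitian_skew square_J gH (f (inord 3)) (f (inord 0)).
rewrite (metric_sym gP) gal0 al0_J; move: (g _ _) => z.
set s := al 0 (f (inord 0)); set h01 := al 1 (f (inord 0)).
set h10 := al 0 (f (inord 3)); set h11 := al 1 (f (inord 3)).
move=> zE1 zE2 Js hsym m1 p1 m0 p0 s0 eq1 eq0.
have bh01 : b * h01 = - (a * s) by lra.
have bh11 : b * h11 = - (c * s) by rewrite hsym in zE1; lra.
have bbh11 : b * (b * h11) = (a ^+ 2 + 1) * s by rewrite bh11 hc; field.
have b2 : 0 < b * b by rewrite -expr2 exprn_even_gt0.
have w0 : 0 < s + h01 by lra.
have w1 : 0 < h01 + h11 by lra.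
split; rewrite -(pmulr_lgt0 _ s0).
  have -> : b * (b - a) * s = b * b * (s + h01) by rewrite -[RHS]mulrA (mulrDr b s) bh01; ring.
  exact: mulr_gt0.
have -> : (a ^+ 2 + 1 - a * b) * s = b * b * (h01 + h11)
  by rewrite -[RHS]mulrA (mulrDr b h01) mulrDr bbh11 bh01; ring.
exact: mulr_gt0.
Qed.

End Necessity.

(** * The inequalities give an explicit CYT metric *)

Section Sufficiency.
Hypotheses (hp0 : 0 < b * (b - a)) (hp1 : 0 < a ^+ 2 + 1 - a * b).

(* The values of h(al_i, al_1 + al_2) when h(al_1, al_1) = 1. *)
Let p0 := (b - a) / b.
Let p1 := (a ^+ 2 + 1 - a * b) / b ^+ 2.

(** [al 0] and [act_form J (al 0)] are orthonormal. The divisions occur because [p0] and [p1] are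
    squared lengths of forms, inverse to those of the dual vectors. *)
Definition CYT_metric (X Y : L) : R :=
  al 0 X * al 0 Y + (a * al 0 X + b * al 1 X) * (a * al 0 Y + b * al 1 Y) +
  (ep 0 X * ep 0 Y + em 0 X * em 0 Y) / p0 +
  (ep 1 X * ep 1 Y + em 1 X * em 1 Y) / p1.

Let p0_gt0 : 0 < p0.
Proof.
have -> : p0 = b * (b - a) / b ^+ 2 by rewrite /p0; field.
by rewrite divr_gt0 // exprn_even_gt0.
Qed.

Let p1_gt0 : 0 < p1.
Proof. by rewrite divr_gt0 // exprn_even_gt0. Qed.

Lemma CYT_metric_hermitian : Defs.hermitian J CYT_metric.
Proof.
split; first split.
- by move=> r X Y Z; rewrite /CYT_metric !one_formP; ring.
- by move=> X Y; rewrite /CYT_metric; ring.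
- move=> X X0; rewrite lt_neqAle; apply/andP; split; last first.
    rewrite /CYT_metric -!expr2.
    by rewrite !(ltW p0_gt0, ltW p1_gt0, sqr_ge0, addr_ge0, divr_ge0) //.
  move: X0; apply: contra_neq => /esym; rewrite /CYT_metric -!expr2.
  move=> /eqP; rewrite !paddr_eq0 ?(ltW p0_gt0, ltW p1_gt0, sqr_ge0, addr_ge0, divr_ge0) //.
  rewrite !mulf_eq0 !invr_eq0 (gt_eqF p0_gt0) (gt_eqF p1_gt0) !orbF.
  rewrite !(@paddr_eq0 _ (_ ^+ 2)) ?sqr_ge0 // !sqrf_eq0 !orbb.
  rewrite -!andbA => /and5P[/eqP al00 h /eqP ep00 /eqP em00 /andP[/eqP ep10 /eqP em10]].
  move: h; rewrite al00 mulr0 add0r mulf_eq0 (negPf b0) => /eqP al10.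
  by apply: (coframe_sep coframe); apply: ord2_ind; rewrite raddf0.
- move=> X Y; rewrite /CYT_metric !actE hc; field.
  by rewrite b0 !gt_eqF.
Qed.

(* S is -J on the (ep, em) plane of the first factor, J on that of the second, *)
(* and 0 on the al plane, so it lies in su(3).                                 *)
Lemma opposite_rotations : exists S : 'End(L), forall X, [/\ forall i, al i (S X) = 0,
  ep 0 (S X) = - em 0 X, em 0 (S X) = ep 0 X, ep 1 (S X) = em 1 X & em 1 (S X) = - ep 1 X].
Proof.
have [e [thE _]] := frame_exists coframe.
pose F X : L := ep 0 X *: e (inord 2) - em 0 X *: e (inord 1) -
    ep 1 X *: e (inord 5) + em 1 X *: e (inord 4).
have FE (th : one_form R) X : th (F X) = ep 0 X * th (e (inord 2)) -
    em 0 X * th (e (inord 1)) - ep 1 X * th (e (inord 5)) + em 1 X * th (e (inord 4)).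
  by rewrite /F raddfD /= !one_formB !one_formZ.
have [S SE] : exists S : 'End(L), S =1 F.
  apply: ex_lfun => r X Y; apply: (coframe_sep coframe) => i;
    rewrite one_formP !FE !one_formP; ring.
exists S => X; rewrite SE; split=> [i||||]; rewrite FE !(frameE thE) !inordK //=; try ring.
by elim/ord2_ind: i => /=; ring.
Qed.

(** The connection is [nabla X = lam X *: S]. All its endomorphisms commute, so the curvature is
    [- lam (bracket X Y) *: S], and both [S] and [J \o S] are traceless because the two rotations
    are opposite. *)
Lemma CYT_sufficient : homogeneous_CYT J.
Proof.
exists CYT_metric; first exact: CYT_metric_hermitian.
have [S SE] := opposite_rotations.
have alS i X : al i (S X) = 0 by case: (SE X).
have ep0S X : ep 0 (S X) = - em 0 X by case: (SE X).
have em0S X : em 0 (S X) = ep 0 X by case: (SE X).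
have ep1S X : ep 1 (S X) = em 1 X by case: (SE X).
have em1S X : em 1 (S X) = - ep 1 X by case: (SE X).
pose rotE := (alS, ep0S, em0S, ep1S, em1S).
(* [lam] is the coefficient for which nabla X = lam X *: S has skew torsion. *)
have [lam lamE] : exists lam : one_form R,
    forall X, lam X = al 0 X - p0 * ((1 + a ^+ 2) * al 0 X + a * b * al 1 X).
  exists (al 0 - p0 *: ((1 + a ^+ 2) *: al 0 + (a * b) *: al 1)) => X.
  by rewrite add_lfunE opp_lfunE !scale_lfunE add_lfunE !scale_lfunE.
have [nabla nablaE] : exists nabla : 'Hom(L, 'End(L)), nabla =1 (fun X => lam X *: S).
  by apply: ex_lfun => r X Y; rewrite one_formP scalerDl scalerA.
have nablaXE X Y : nabla X Y = lam X *: S Y by rewrite nablaE scale_lfunE.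
have SJ X : S (J X) = J (S X).
  apply: (coframe_sep coframe); apply: ord2_ind; by rewrite !(actE, rotE); ring.
have nablaJ X Y : nabla X (J Y) = J (nabla X Y) by rewrite !nablaXE SJ linearZ.
exists nabla.
  split=> // X Y Z.
    (* [S] is skew: it rotates each [ep], [em] plane, where the metric is a multiple of the standard
       one. *)
    rewrite /CYT_metric !nablaXE !one_formZ !rotE; ring.
  rewrite /CYT_metric /torsion !nablaXE !one_formB !one_formZ !rotE.
  rewrite !(bracketE coframe) !lamE /p0 /p1.
  have ba : b - a != 0 by apply: contraTneq hp0 => ->; rewrite mulr0 ltxx.
  by field; rewrite b0 ba gt_eqF.
move=> X Y; apply/(ricci_form_eq0 square_J nablaJ).
have [e [thE eE]] := frame_exists coframe.
rewrite !(trE _ eE) !sum_coframe !comp_lfunE.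
have curvE Z : curvature nabla X Y Z = - lam (bracket X Y) *: S Z.
  rewrite /curvature !add_lfunE !opp_lfunE !comp_lfunE !nablaXE.
  by rewrite ![S (_ *: _)]linearZ /= !scalerA mulrC subrr sub0r scaleNr.
rewrite !curvE !(actE, one_formZ, rotE, frameE thE) !inordK //=.
by split; ring.
Qed.

End Sufficiency.
End ComplexStructure.

Theorem proposition3 (R : realType) (al ep em : 'I_2 -> one_form R)
    (hcoframe : Maurer_Cartan_coframe al ep em)
    (a b c d : R) (hb : b != 0)
    (hc : c = - ((a ^+ 2 + 1) / b)) (hd : d = - a)
    (J : 'End(su2su2 R))
    (hJal1 : act_form J (al 0) = a *: al 0 + b *: al 1)
    (hJal2 : act_form J (al 1) = c *: al 0 + d *: al 1)
    (hJep : forall i : 'I_2, act_form J (ep i) = em i)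
    (hJem : forall i : 'I_2, act_form J (em i) = - ep i) :
  homogeneous_CYT J <-> 0 < b * (b - a) /\ 0 < a ^+ 2 + 1 - a * b.
Proof.
split=> [[g gH [nabla hB ricci0]]|[h0 h1]].
  exact: (CYT_necessary hcoframe hb hc hd hJal1 hJal2 hJep hJem gH hB ricci0).
exact: (CYT_sufficient hcoframe hb hc hd hJal1 hJal2 hJep hJem h0 h1).
Qed.
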